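(* Let $\Delta=(z_0^{(0)},z_1^{(0)},z_2^{(0)})$ with $z_i^{(0)}\in\mathbb{C}$ be an arbitrary triangle with $z_i^{(0)}\neq z_j^{(0)}$ for $i\neq j$, whose centroid is the origin, i.e. $z_0^{(0)}+z_1^{(0)}+z_2^{(0)}=0$. Define recursively, for $n\ge 1$ and $i\in\mathbb{Z}_3$, $$z_i^{(n)}=\tfrac{2}{3}\,r_i^{(n-1)}z_i^{(n-1)}-\tfrac13\, r_{i+1}^{(n-1)}z_{i+1}^{(n-1)}-\tfrac13\, r_{i+2}^{(n-1)}z_{i+2}^{(n-1)},\qquad r_i^{(n)}=\frac{|z_{i-1}^{(n)}|}{|z_i^{(n)}|}\quad(n\ge 0).$$ Then $\lim_{n\to\infty} r_i^{(n)}=1$ for $i=0,1,2$, i.e. the ratio of the distances from the vertices to the centroid converges to $1$.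
   Context: Indices $i$ are taken modulo $3$. The centroid of a triangle $(z_0,z_1,z_2)$ is $\frac13(z_0+z_1+z_2)$; it is assumed without loss of generality to be the origin, and the recursion keeps it there.
   Formalization: The triangle is assumed non-degenerate (its three vertices are not collinear); for distinct collinear vertices with centroid 0, e.g. 1, 2, -3, one modulus is always the sum of the other two, so the ratios cannot all tend to 1. *)

(* Defs.v *)
From HB Require Import structures.
From mathcomp Require Import all_boot all_order all_algebra.
From mathcomp Require Import all_classical all_reals all_analysis.
From mathcomp Require Import complex.

Set Implicit Arguments.
Unset Strict Implicit.
Unset Printing Implicit Defensive.

Import Order.TTheory GRing.Theory Num.Theory.
Import numFieldNormedType.Exports.

Local Open Scope ring_scope.
Local Open Scope complex_scope.

(* The modulus as an element of R; the generic norm on R[i] takes its values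
   in R[i]. *)
Definition cmod (R : realType) (x : R[i]) : R := ComplexField.Normc.normc x.

(* v = 0 is allowed, so coinciding points are collinear. *)
Definition collinear3 (R : realType) (z : 'Z_3 -> R[i]) : Prop :=
  exists p v : R[i], forall i, exists t : R, z i = p + t%:C * v.

(* Main.v *)
(** One step turns z_i into r_i z_i, of modulus |z_(i-1)|, and recentres at the
    centroid. Permuting the moduli preserves the sum of the |z_i|^2 and
    recentring can only decrease it. The signed area, on the other hand, is
    multiplied by the mean of the 1 / r_i, which is at least 1 by AM-GM because
    the r_i have product 1. The area is bounded by the sum of squares, so it
    converges to a nonzero limit, the mean of the 1 / r_i tends to 1, and the
    stability of AM-GM forces each r_i to tend to 1. *)
Require Import Defs.
From HB Require Import structures.
From mathcomp Require Import all_boot all_order all_algebra.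
From mathcomp Require Import all_classical all_reals all_analysis.
From mathcomp Require Import complex.
From mathcomp Require Import ring lra.
Set Implicit Arguments.
Unset Strict Implicit.
Unset Printing Implicit Defensive.

Import Order.TTheory GRing.Theory Num.Theory.
Import numFieldNormedType.Exports.
Local Open Scope classical_set_scope.
Local Open Scope ring_scope.
Local Open Scope complex_scope.

(* Since the z_i sum to 0, this takes the same value on all three pairs
   (z_i, z_(i+1)): two thirds of the signed area of the triangle. *)
Definition cross (R : realType) (u v : R[i]) : R :=
  complex.Re u * complex.Im v - complex.Im u * complex.Re v.

Definition normsq (R : realType) (u : R[i]) : R :=
  complex.Re u ^+ 2 + complex.Im u ^+ 2.

Lemma cmod_sq (R : realType) (u : R[i]) : cmod u ^+ 2 = normsq u.
Proof. by case: u => a b; rewrite /cmod /normsq /= sqr_sqrtr// addr_ge0 ?sqr_ge0. Qed.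

Lemma cmod_gt0 (R : realType) (u : R[i]) : 0 < normsq u -> 0 < cmod u.
Proof. by case: u => a b; rewrite /normsq /cmod /= sqrtr_gt0. Qed.

Lemma normsq_gt0_cross (R : realType) (u v : R[i]) :
  cross u v != 0 -> 0 < normsq u /\ 0 < normsq v.
Proof.
rewrite /cross /normsq; case: u v => [a b] [c d] /= h.
suff gt0 (s t : R) : (s != 0) || (t != 0) -> 0 < s ^+ 2 + t ^+ 2.
  split; apply: gt0; rewrite -negb_and; apply: contra h => /andP[/eqP-> /eqP->];
    by apply/eqP; ring.
move=> st; rewrite lt0r addr_ge0 ?sqr_ge0// andbT paddr_eq0 ?sqr_ge0//.
by rewrite !sqrf_eq0 negb_and.
Qed.

Lemma cross_le_normsq (R : realType) (u v : R[i]) :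
  `|cross u v| <= normsq u + normsq v.
Proof.
rewrite /cross /normsq; case: u v => [a b] [c d] /=.
(* The squares of [a - d] and [b + c] give the upper bound, those of [a + d] and [b - c] the lower
   one. *)
have := sqr_ge0 (a - d); have := sqr_ge0 (b + c).
have := sqr_ge0 (a + d); have := sqr_ge0 (b - c).
have := sqr_ge0 a; have := sqr_ge0 b; have := sqr_ge0 c; have := sqr_ge0 d.
by move=> *; rewrite ler_norml; apply/andP; split; nra.
Qed.

(** With the centroid at the origin, parallel [z 0] and [z 1] put all three vertices on a line
    through the origin, so the base point is 0 and the direction is [z 0], or [z 1] when [z 0]
    vanishes. *)
Lemma collinear3_cross0 (R : realType) (z : 'Z_3 -> R[i]) :
  z 0 + z 1 + z 2 = 0 -> cross (z 0) (z 1) = 0 -> collinear3 z.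
Proof.
move=> hs hc.
have I3 (P : 'Z_3 -> Prop) : P 0 -> P 1 -> P 2 -> forall i, P i.
  move=> p0 p1 p2 [[|[|[|//]]] Hi].
  - by rewrite (_ : Ordinal Hi = 0) //; apply/val_inj.
  - by rewrite (_ : Ordinal Hi = 1) //; apply/val_inj.
  - by rewrite (_ : Ordinal Hi = 2) //; apply/val_inj.
have hz2 : z 2 = - z 0 - z 1 by apply/eqP; rewrite -subr_eq0 -hs; apply/eqP; ring.
have [z00|z00] := eqVneq (z 0) 0.
  exists 0, (z 1); apply: I3; [exists 0|exists 1|exists (-1)].
  - by rewrite z00 mul0r addr0.
  - by rewrite mul1r add0r.
  - by rewrite hz2 z00 rmorphN rmorph1; ring.
have [t zt] : exists t : R, z 1 = t%:C * z 0.
  move: hc z00; rewrite /cross; case: (z 0) (z 1) => [a b] [c d] /= hc z00.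
  have n0 : a ^+ 2 + b ^+ 2 != 0.
    rewrite paddr_eq0 ?sqr_ge0// !sqrf_eq0; apply: contra z00.
    by move=> /andP[/eqP-> /eqP->].
  (* The coefficient of the orthogonal projection of [z 1] onto [z 0]. *)
  exists ((a * c + b * d) / (a ^+ 2 + b ^+ 2)).
  have e : a * d = b * c by lra.
  apply/eqP; rewrite eq_complex /=; apply/andP; split; apply/eqP.
  - rewrite mul0r subr0; apply: (mulIf n0).
    transitivity (a * (a * c) + b * (b * c)); first by ring.
    by rewrite -e; field.
  - rewrite mul0r addr0; apply: (mulIf n0).
    transitivity (a * (a * d) + b * (b * d)); first by ring.
    by rewrite e; field.
exists 0, (z 0); apply: I3; [exists 1|exists t|exists (-1 - t)].
- by rewrite mul1r add0r.
- by rewrite add0r.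
- by rewrite hz2 zt rmorphB rmorphN rmorph1; ring.
Qed.

(** The weights are free reals, and the three new vertices are the cyclic rotations of this one
    expression. *)
Definition step (R : realType) (a b c : R) (u v w : R[i]) : R[i] :=
  2 / 3 * a%:C * u - 1 / 3 * b%:C * v - 1 / 3 * c%:C * w.

Lemma Re_step (R : realType) (a b c : R) (u v w : R[i]) :
  complex.Re (step a b c u v w) =
  2 / 3 * a * complex.Re u - 1 / 3 * b * complex.Re v - 1 / 3 * c * complex.Re w.
Proof.
rewrite /step; have -> : (2 / 3 : R[i]) = (2 / 3)%:C by rewrite rmorphM fmorphV !rmorph_nat.
have -> : (1 / 3 : R[i]) = (1 / 3)%:C by rewrite rmorphM fmorphV !rmorph_nat.
by case: u v w => [? ?] [? ?] [? ?] /=; ring.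
Qed.

Lemma Im_step (R : realType) (a b c : R) (u v w : R[i]) :
  complex.Im (step a b c u v w) =
  2 / 3 * a * complex.Im u - 1 / 3 * b * complex.Im v - 1 / 3 * c * complex.Im w.
Proof.
rewrite /step; have -> : (2 / 3 : R[i]) = (2 / 3)%:C by rewrite rmorphM fmorphV !rmorph_nat.
have -> : (1 / 3 : R[i]) = (1 / 3)%:C by rewrite rmorphM fmorphV !rmorph_nat.
by case: u v w => [? ?] [? ?] [? ?] /=; ring.
Qed.

(** Minimising over [y] and [w] leaves a cubic in [x] with a double root at 1. The cap 7/2 keeps the
    excess [t] at most 1/2; the constant is 46 = 23 / (1/2), from the bounds [half] and [up]. *)
Lemma amgm_stability (R : realFieldType) (x y w : R) :
  0 < x -> 0 < y -> 0 < w -> x * y * w = 1 -> x + y + w <= 7 / 2 ->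
  (x - 1) ^+ 2 <= 46 * (x + y + w - 3).
Proof.
move=> x0 y0 w0 e s.
have h : 4 <= x * (y + w) ^+ 2.
  have -> : x * (y + w) ^+ 2 = x * (y - w) ^+ 2 + 4 * (x * y * w) by ring.
  by rewrite e mulr1 lerDr mulr_ge0 ?sqr_ge0 ?ltW.
set t := x + y + w - 3.
have yw : y + w = 3 + t - x by rewrite /t; ring.
(* [4 - x * (3 - x) ^+ 2 = (x - 1) ^+ 2 * (4 - x)] *)
have k : (x - 1) ^+ 2 * (4 - x) <= t * (x * (6 + t - 2 * x)).
  rewrite -subr_ge0 (_ : _ - _ = x * (y + w) ^+ 2 - 4) ?subr_ge0//.
  by rewrite yw; ring.
have x3 : x <= 3.
  (* Otherwise [x * (y + w) ^+ 2] is at most [x], hence at most 7/2, against [h]. *)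
  rewrite leNgt; apply/negP => x3; have yw1 : y + w <= 1 by lra.
  have : (y + w) ^+ 2 <= 1 by apply: exprn_ile1 => //; lra.
  by move/(ler_wpM2l (ltW x0)); lra.
have th : t <= 1 / 2 by rewrite /t; lra.
have half : (x - 1) ^+ 2 * (1 / 2) <= (x - 1) ^+ 2 * (4 - x).
  by apply: ler_wpM2l; [exact: sqr_ge0|lra].
have pos : 0 < x * (6 + t - 2 * x) by apply: mulr_gt0 => //; rewrite /t; lra.
have t0 : 0 <= t.
  rewrite -(pmulr_lge0 _ pos); apply: le_trans k.
  by apply: mulr_ge0; [exact: sqr_ge0|lra].
have up : x * (6 + t - 2 * x) <= 23 by nra.
by have := ler_wpM2l t0 up; lra.
Qed.

(** A sum below 3 is also below 7/2, and [amgm_stability] would bound a square by a negative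
    number. *)
Lemma amgm3 (R : realFieldType) (x y w : R) :
  0 < x -> 0 < y -> 0 < w -> x * y * w = 1 -> 3 <= x + y + w.
Proof.
move=> x0 y0 w0 e; rewrite leNgt; apply/negP => lt3.
have := @amgm_stability _ x y w x0 y0 w0 e; have := sqr_ge0 (x - 1); lra.
Qed.

Lemma amgm_cvg (R : realType) (x y w : nat -> R) :
  (forall n, [/\ 0 < x n, 0 < y n & 0 < w n]) ->
  (forall n, x n * y n * w n = 1) ->
  x n + y n + w n @[n --> \oo] --> (3 : R) -> x n @[n --> \oo] --> (1 : R).
Proof.
move=> pos e s3.
have b0 : 46 * (x n + y n + w n - 3) @[n --> \oo] --> (0 : R).
  rewrite -(mulr0 46) -(subrr 3); apply: cvgM; first exact: cvg_cst.
  by apply: cvgB => //; exact: cvg_cst.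
have sq0 : (x n - 1) ^+ 2 @[n --> \oo] --> (0 : R).
  apply: (@squeeze_cvgr _ _ _ _ (fun=> 0) _ _ _ _ (cvg_cst _) b0).
  (* The cap 7/2 holds only eventually, because the sum tends to 3. *)
  near=> n; rewrite sqr_ge0 /=; case: (pos n) => x0 y0 w0.
  apply: amgm_stability => //; apply: ltW; near: n.
  by apply: (cvgr_lt _ s3); lra.
apply/cvgrPdist_lt => d d0.
near=> n.
have : (x n - 1) ^+ 2 < d ^+ 2.
  by near: n; apply: (cvgr_lt _ sq0); rewrite exprn_gt0.
by rewrite distrC -real_normK ?num_real// ltr_pXn2r// ?nnegrE// ltW.
Unshelve. all: by end_near.
Qed.

Lemma step_sum (R : realType) (a b c : R) (u v w : R[i]) :
  step a b c u v w + step b c a v w u + step c a b w u v = 0.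
Proof. by rewrite /step; field. Qed.

(** Recentring preserves area, and the triangle [a u], [b v], [c w] splits at the origin into three
    whose cross products are [a b], [b c] and [c a] times the common value [cross u v]. *)
Lemma cross_step (R : realType) (a b c : R) (u v w : R[i]) : u + v + w = 0 ->
  cross (step a b c u v w) (step b c a v w u) =
  cross u v * ((a * b + b * c + c * a) / 3).
Proof.
move=> s; have -> : w = - u - v by apply/eqP; rewrite -subr_eq0 -s; apply/eqP; ring.
rewrite /cross !Re_step !Im_step.
by case: u v {s} => [? ?] [? ?] /=; field.
Qed.

(** Parallel axis identity: the loss is three times the squared modulus of the centroid of [a u],
    [b v], [c w]. *)
Lemma normsq_step (R : realType) (a b c : R) (u v w : R[i]) :
  normsq (step a b c u v w) + normsq (step b c a v w u) +
    normsq (step c a b w u v) <=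
  a ^+ 2 * normsq u + b ^+ 2 * normsq v + c ^+ 2 * normsq w.
Proof.
rewrite /normsq !Re_step !Im_step.
case: u v w => [u1 u2] [v1 v2] [w1 w2] /=.
rewrite -subr_ge0 (_ : _ - _ = ((a * u1 + b * v1 + c * w1) ^+ 2 +
  (a * u2 + b * v2 + c * w2) ^+ 2) / 3); last by field.
by rewrite divr_ge0 ?addr_ge0 ?sqr_ge0.
Qed.

Theorem theorem1 (R : realType)
    (z : nat -> 'Z_3 -> R[i]) (r : nat -> 'Z_3 -> R)
    (hdistinct : forall i j : 'Z_3, i <> j -> z 0%N i <> z 0%N j)
    (htriangle : ~ collinear3 (z 0%N))
    (hcentroid : z 0%N 0 + z 0%N 1 + z 0%N 2 = 0)
    (hz : forall (n : nat) (i : 'Z_3),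
      z n.+1 i = 2 / 3 * (r n i)%:C * z n i
                 - 1 / 3 * (r n (i + 1))%:C * z n (i + 1)
                 - 1 / 3 * (r n (i + 2))%:C * z n (i + 2))
    (hr : forall (n : nat) (i : 'Z_3),
      r n i = cmod (z n (i - 1)) / cmod (z n i)) :
  forall i : 'Z_3, r n i @[n --> \oo] --> (1 : R).
Proof.
have zE n i j k : i + 1 = j -> i + 2 = k ->
    z n.+1 i = step (r n i) (r n j) (r n k) (z n i) (z n j) (z n k).
  by move=> <- <-; exact: hz.
have z0S n : z n.+1 0 = step (r n 0) (r n 1) (r n 2) (z n 0) (z n 1) (z n 2).
  by apply: zE; apply/val_inj.
have z1S n : z n.+1 1 = step (r n 1) (r n 2) (r n 0) (z n 1) (z n 2) (z n 0).
  by apply: zE; apply/val_inj.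
have z2S n : z n.+1 2 = step (r n 2) (r n 0) (r n 1) (z n 2) (z n 0) (z n 1).
  by apply: zE; apply/val_inj.
have rE n i k : i - 1 = k -> r n i = cmod (z n k) / cmod (z n i).
  by move=> <-; exact: hr.
have r0E n : r n 0 = cmod (z n 2) / cmod (z n 0) by apply: rE; apply/val_inj.
have r1E n : r n 1 = cmod (z n 0) / cmod (z n 1) by apply: rE; apply/val_inj.
have r2E n : r n 2 = cmod (z n 1) / cmod (z n 2) by apply: rE; apply/val_inj.
have sum0 n : z n 0 + z n 1 + z n 2 = 0.
  by case: n => [//|n]; rewrite z0S z1S z2S step_sum.
pose S n := cross (z n 0) (z n 1).
pose p n := ((r n 0)^-1 + (r n 1)^-1 + (r n 2)^-1) / 3.
(* A nonzero area keeps the vertices off the centroid, so no ratio [r n i] involves a division by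
   0. *)
have modpos n : S n != 0 -> [/\ 0 < cmod (z n 0), 0 < cmod (z n 1) & 0 < cmod (z n 2)].
  move=> Sn; have [q0 q1] := normsq_gt0_cross Sn.
  have z2E : z n 2 = - z n 0 - z n 1.
    by apply/eqP; rewrite -subr_eq0 -(sum0 n); apply/eqP; ring.
  have [|q2 _] := @normsq_gt0_cross _ (z n 2) (z n 0).
    rewrite (_ : cross _ _ = S n) // z2E /S /cross.
    by case: (z n 0) (z n 1) => [? ?] [? ?] /=; ring.
  by split; exact: cmod_gt0.
(* The [r n i] have product 1, so their pairwise products are their inverses. *)
have SS n : S n != 0 -> S n.+1 = S n * p n.
  move=> /modpos[m0 m1 m2].
  rewrite /S z0S z1S cross_step // /p r0E r1E r2E; congr (_ * _).
  by field; rewrite !gt_eqF.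
have ppos n : S n != 0 -> 1 <= p n.
  move=> /modpos[m0 m1 m2]; rewrite /p ler_pdivlMr // mul1r r0E r1E r2E.
  by apply: amgm3; rewrite ?invr_gt0 ?divr_gt0 //; field; rewrite !gt_eqF.
(* The area factor is at least 1, so nondegeneracy passes from each triangle to the next. *)
have S_neq0 n : S n != 0.
  elim: n => [|n IHn].
    by apply/eqP => S0; apply: htriangle; exact: collinear3_cross0.
  by rewrite SS // mulf_neq0 // gt_eqF // (lt_le_trans ltr01) // ppos.
pose Q n := normsq (z n 0) + normsq (z n 1) + normsq (z n 2).
have QS n : Q n.+1 <= Q n.
  have [m0 m1 m2] := modpos n (S_neq0 n).
  rewrite {1}/Q z0S z1S z2S; apply: le_trans (normsq_step _ _ _ _ _ _) _.
  rewrite /Q -!cmod_sq r0E r1E r2E !expr_div_n !divfK ?expf_eq0 ?gt_eqF //.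
  by rewrite -addrA addrC.
have Qle n : Q n <= Q 0%N by elim: n => // n; exact: le_trans (QS n).
have SQ n : `|S n| <= Q 0%N.
  apply: le_trans (Qle n); apply: le_trans (cross_le_normsq _ _) _.
  by rewrite /Q lerDl addr_ge0 ?sqr_ge0.
have normS n : `|S n.+1| = `|S n| * p n.
  by rewrite SS // normrM (ger0_norm (le_trans ler01 (ppos n (S_neq0 n)))).
have Sndecr : nondecreasing_seq (fun n => `|S n|).
  by apply/nondecreasing_seqP => n; rewrite normS ler_peMr // ppos.
have Scvg : cvgn (fun n => `|S n|).
  by apply: nondecreasing_is_cvgn => //; exists (Q 0%N) => _ [n _ <-].
have L_neq0 : limn (fun n => `|S n|) != 0.
  rewrite gt_eqF //; apply: (@lt_le_trans _ _ `|S 0%N|); first by rewrite normr_gt0.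
  exact: (nondecreasing_cvgn_le Sndecr Scvg).
(* [p n] is the quotient of consecutive terms of a sequence with nonzero limit. *)
have pcvg : p n @[n --> \oo] --> (1 : R).
  have -> : p = (fun n => `|S n.+1| * `|S n|^-1).
    by apply/funext => n; rewrite normS mulrAC divff ?mul1r // normr_eq0.
  rewrite -(divff L_neq0); apply: cvgM; last exact: cvgV.
  by rewrite (cvg_shiftS (fun n => `|S n|)).
have sumcvg : (r n 0)^-1 + (r n 1)^-1 + (r n 2)^-1 @[n --> \oo] --> (3 : R).
  rewrite (_ : (fun n => _) = (fun n => p n * 3)); last first.
    by apply/funext => n; rewrite /p divfK.
  by rewrite -[X in _ --> X](mul1r 3); apply: cvgM => //; exact: cvg_cst.
have rpos n : [/\ 0 < (r n 0)^-1, 0 < (r n 1)^-1 & 0 < (r n 2)^-1].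
  have [m0 m1 m2] := modpos n (S_neq0 n).
  by rewrite r0E r1E r2E !invr_gt0 !divr_gt0.
have rprod n : (r n 0)^-1 * (r n 1)^-1 * (r n 2)^-1 = 1.
  have [m0 m1 m2] := modpos n (S_neq0 n).
  by rewrite r0E r1E r2E; field; rewrite !gt_eqF.
have inv_cvg i : (r n i)^-1 @[n --> \oo] --> (1 : R) -> r n i @[n --> \oo] --> (1 : R).
  move=> h; rewrite -[X in _ --> X]invr1; rewrite (_ : r ^~ i = (fun n => (r n i)^-1^-1)); last first.
    by apply/funext => n; rewrite invrK.
  by apply: cvgV => //; exact: oner_neq0.
move=> i; apply: inv_cvg; case: i => [[|[|[|//]]] hi].
- rewrite (_ : Ordinal hi = 0); last exact/val_inj.
  exact: (amgm_cvg rpos rprod).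
- rewrite (_ : Ordinal hi = 1); last exact/val_inj.
  (* [amgm_cvg] concerns the first factor, so the inverses are rotated to bring the wanted one to
     the front. *)
  apply: (@amgm_cvg _ _ (fun n => (r n 2)^-1) (fun n => (r n 0)^-1)).
  + by move=> n; have [] := rpos n.
  + by move=> n; rewrite -(rprod n); ring.
  + by under eq_fun do rewrite addrC addrA.
- rewrite (_ : Ordinal hi = 2); last exact/val_inj.
  apply: (@amgm_cvg _ _ (fun n => (r n 0)^-1) (fun n => (r n 1)^-1)).
  + by move=> n; have [] := rpos n.
  + by move=> n; rewrite -(rprod n); ring.
  + by under eq_fun do rewrite -addrA addrC.
Qed.
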